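(* Let $k,n_1,n_2\ge 1$ be integers, let $A\in\mathbb{R}^{n_1\times k}$ and $B\in\mathbb{R}^{n_2\times k}$ be (deterministic) matrices, and let $X_{n_1,k}$ (an $n_1\times k$ matrix) and $X_{n_2,k}$ (an $n_2\times k$ matrix) be random real matrices all of whose entries (across both matrices) are independent, identically distributed symmetric random variables with variance $1$ and all moments finite. For $\theta\ge 0$ put $$A_\theta=A+\sqrt{\theta}\,X_{n_1,k},\qquad B_\theta=B+\sqrt{\theta}\,X_{n_2,k},$$ $$\tilde h(x,u,\theta)=\mathbb{E}\left\{\det\left[xI_k+(u-1)A_\theta^{\intercal}A_\theta+u\,B_\theta^{\intercal}B_\theta\right]\right\},\qquad h(x,u)=\tilde h(x,u,0).$$ Let $\tilde w(\theta)$ be a differentiable function on $[0,\varepsilon)$ for some $\varepsilon>0$ (one-sided derivative at $0$) such that $\tilde h(0,\tilde w(\theta),\theta)=0$ for all $\theta\in[0,\varepsilon)$. Write $w=\tilde w(0)$ and $w'=\tilde w'(0)$, and suppose $h_1(0,w)\neq 0$. Then $$w'\,\frac{h_2(0,w)}{h_1(0,w)}=-(n_1-k+1)(w-1)-(n_2-k+1)\,w-w(w-1)\,\frac{h_{12}(0,w)}{h_1(0,w)}.$$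
   Context: A random variable $Y$ is symmetric if $Y$ and $-Y$ have the same distribution. $M^{\intercal}$ denotes the transpose of $M$. Subscripts on $h$ denote partial derivatives with respect to the indicated arguments: $h_1=\partial h/\partial x$, $h_2=\partial h/\partial u$, $h_{12}=\partial^2 h/\partial x\,\partial u$. The roots $u$ of $\det[(u-1)A^{\intercal}A+uB^{\intercal}B]$ are the squares of the generalized singular values (squared cosines) of the pair $(A,B)$. *)

(* Defs.v *)
From HB Require Import structures.
From mathcomp Require Import all_boot all_order all_algebra.
From mathcomp Require Import all_classical all_reals all_analysis.
From mathcomp Require Import measurable_realfun.

Set Implicit Arguments.
Unset Strict Implicit.
Unset Printing Implicit Defensive.

Import Order.TTheory GRing.Theory Num.Theory.
Import numFieldNormedType.Exports.

Local Open Scope classical_set_scope.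
Local Open Scope ring_scope.

Definition mutually_independent {d : measure_display} {T : measurableType d}
    {R : realType} {P : probability T R} {I : finType}
    (X : I -> {RV P >-> R}) : Prop :=
  forall (J : {set I}) (E : I -> set R),
    (forall i, i \in J -> measurable (E i)) ->
    P [set t | forall i, i \in J -> E i (X i t)] =
    (\prod_(i in J) P (X i @^-1` E i))%E.

Definition same_distribution {d : measure_display} {T : measurableType d}
    {R : realType} {P : probability T R} (X Y : {RV P >-> R}) : Prop :=
  forall E : set R, measurable E -> distribution P X E = distribution P Y E.

Definition symmetric_rv {d : measure_display} {T : measurableType d}
    {R : realType} {P : probability T R} (X : {RV P >-> R}) : Prop :=
  same_distribution X (\- X : {mfun T >-> R}).

Definition finite_moments {d : measure_display} {T : measurableType d}
    {R : realType} {P : probability T R} (X : {RV P >-> R}) : Prop :=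
  forall m : nat, P.-integrable [set: T] (fun t => (X t ^+ m)%:E).

(* The single family made of the entries of both random matrices. *)
Definition all_entries {d : measure_display} {T : measurableType d}
    {R : realType} {P : probability T R} {k n1 n2 : nat}
    (X1 : 'I_n1 -> 'I_k -> {RV P >-> R}) (X2 : 'I_n2 -> 'I_k -> {RV P >-> R})
    (e : 'I_n1 * 'I_k + 'I_n2 * 'I_k) : {RV P >-> R} :=
  match e with
  | inl ij => X1 ij.1 ij.2
  | inr ij => X2 ij.1 ij.2
  end.

Definition perturb_mx {d : measure_display} {T : measurableType d}
    {R : realType} {P : probability T R} {n k : nat}
    (A : 'M[R]_(n, k)) (X : 'I_n -> 'I_k -> {RV P >-> R})
    (theta : R) (t : T) : 'M[R]_(n, k) :=
  A + Num.sqrt theta *: \matrix_(i < n, j < k) X i j t.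

(* [fine] is harmless when all entries have finite moments: the determinant is
   a polynomial in independent entries, hence integrable. *)
Definition htilde {d : measure_display} {T : measurableType d}
    {R : realType} {P : probability T R} {k n1 n2 : nat}
    (A : 'M[R]_(n1, k)) (B : 'M[R]_(n2, k))
    (X1 : 'I_n1 -> 'I_k -> {RV P >-> R}) (X2 : 'I_n2 -> 'I_k -> {RV P >-> R})
    (x u theta : R) : R :=
  fine ('E_P[fun t =>
    let Atheta := perturb_mx A X1 theta t in
    let Btheta := perturb_mx B X2 theta t in
    \det (x%:M + (u - 1) *: (Atheta^T *m Atheta)
               + u *: (Btheta^T *m Btheta))])%E.

Definition partial1 {R : realType} (f : R -> R -> R) (x u : R) : R :=
  derive1 (f^~ u) x.

Definition partial2 {R : realType} (f : R -> R -> R) (x u : R) : R :=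
  derive1 (f x) u.

Definition is_right_derivative {R : realType} (f : R -> R) (a l : R) : Prop :=
  e^-1 * (f (a + e) - f a) @[e --> 0^'+] --> l.

(* Main.v *)
Require Import Defs.
From mathcomp Require Import all_boot all_order all_algebra.
From mathcomp Require Import all_classical all_reals all_analysis.
From mathcomp Require Import measurable_realfun.
From mathcomp Require Import perm ring lra.

Set Implicit Arguments.
Unset Strict Implicit.
Unset Printing Implicit Defensive.

Import Order.TTheory GRing.Theory Num.Theory.
Import numFieldNormedType.Exports.

Local Open Scope classical_set_scope.
Local Open Scope ring_scope.

(** Write h(x, u) = det(x I + N_u) with N_u = (u - 1) A^T A + u B^T B.
    Expanding the determinant in the noise, only the terms of degree 0 and 2
    survive in expectation up to o(theta), and the degree-2 term sees the noise
    only through its covariance. Hence E det = h(0, u) + theta L(u) + o(theta),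
    where L is half the Laplacian of det N_u in the entries of A and B.

    A single entry perturbs N_u through one row r of weight d (u - 1 for the
    rows of A, u for those of B), so the matrix determinant lemma makes the
    contribution of that row d tr adj(N_u - d r^T r), which Jacobi's formula
    turns into the x-derivative at 0 of d det S - d^2 r adj(S) r^T, with
    S = x I + N_u. As u - 1 and u are the roots of d^2 = (2u - 1) d - u (u - 1),
    the sum over the rows is a combination of h_1(0, u) and h_12(0, u).
    Dividing h(0, w(theta)) + theta L(w(theta)) + o(theta) = 0 by theta and
    letting theta -> 0+ gives w' h_2(0, w) + L(w) = 0. *)

(** * Determinants and adjugates *)

(** The determinant of the bordered matrix [K] is computed twice. A unipotent factor on the right
    clears [r] and leaves [N + v *m r]; a factor built from [\adj N] on the left makes [K] block
    triangular. The second count carries an extra [\det N ^+ k], cancelled using [\det N != 0]. *)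
Lemma det_rank1_nz (R : idomainType) (k : nat) (N : 'M[R]_k)
    (v : 'cV[R]_k) (r : 'rV[R]_k) : \det N != 0 ->
  \det (N + v *m r) = \det N + (r *m \adj N *m v) 0 0.
Proof.
move=> N0.
pose K := block_mx N (- v) r (1%:M : 'M[R]_1).
have K1 : \det K = \det (N + v *m r).
  have := det_mulmx K (block_mx 1%:M 0 (- r) (1%:M : 'M[R]_1)).
  rewrite mulmx_block !mulmx1 !mulmx0 !mul1mx mulmxN mulNmx opprK subrr.
  by rewrite !add0r det_ublock det_lblock !det1 !mulr1.
have K2 : \det (\adj N) * \det N * \det K
    = \det N ^+ k * (\det N + (r *m \adj N *m v) 0 0).
  have := det_mulmx (block_mx (\adj N) 0 (- (r *m \adj N)) ((\det N)%:M : 'M[R]_1)) K.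
  rewrite mulmx_block !mul0mx !addr0 mul_adj_mx !mulNmx !mulmxN opprK -!mulmxA.
  rewrite mul_adj_mx mul_mx_scalar mul_scalar_mx addNr mulmx1.
  rewrite det_lblock det_ublock det_scalar !det_mx11 !mulmxA => E.
  have sc (a : R) : (a%:M : 'M[R]_1) 0 0 = a by rewrite mxE.
  by rewrite mxE !sc addrC in E.
have adjN : \det (\adj N) * \det N = \det N ^+ k.
  by rewrite -det_mulmx mul_adj_mx det_scalar.
rewrite -K1; apply: (mulfI (expf_neq0 k N0)).
by rewrite -{1}adjN K2.
Qed.

(** Genericity argument: [X + N] over [{poly R}] has a monic, hence nonzero, determinant, so the
    previous case applies to it; evaluation at X = 0 returns to [N]. *)
Lemma det_rank1 (R : idomainType) (k : nat) (N : 'M[R]_k)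
    (v : 'cV[R]_k) (r : 'rV[R]_k) :
  \det (N + v *m r) = \det N + (r *m \adj N *m v) 0 0.
Proof.
pose NX : 'M[{poly R}]_k := char_poly_mx (- N).
have NX0 : \det NX != 0 by rewrite monic_neq0 // char_poly_monic.
have ev : map_mx (horner_eval 0) NX = N.
  apply/matrixP => i j; rewrite !mxE /horner_eval hornerD hornerN hornerMn.
  by rewrite hornerX hornerC mul0rn add0r opprK.
have evC m n (M : 'M[R]_(m, n)) : map_mx (horner_eval 0) (map_mx polyC M) = M.
  by apply/matrixP => i j; rewrite !mxE /horner_eval hornerC.
have := congr1 (horner_eval 0)
  (det_rank1_nz (map_mx polyC v) (map_mx polyC r) NX0).
rewrite rmorphD /= -!det_map_mx map_mxD map_mxM !evC ev => ->.
congr (_ + _).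
transitivity ((map_mx (horner_eval 0)
  (map_mx polyC r *m \adj NX *m map_mx polyC v)) 0 0); first by rewrite [RHS]mxE.
by rewrite !map_mxM map_mx_adj !evC ev.
Qed.

Lemma deriv_prod (R : comNzRingType) (I : finType) (F : I -> {poly R}) :
  (\prod_i F i)^`() = \sum_i (F i)^`() * \prod_(j | j != i) F j.
Proof.
have H : forall s : seq I, uniq s -> (\prod_(i <- s) F i)^`()
    = \sum_(i <- s) (F i)^`() * \prod_(j <- s | j != i) F j.
  elim=> [|a s IH]; first by rewrite !big_nil derivC.
  move=> /= /andP[as_ us]; rewrite !big_cons derivM IH // eqxx /=.
  congr (_ + _).
    rewrite [in RHS]big_seq_cond [in LHS]big_seq.
    congr (_ * _); apply: eq_bigl => j.
    by case: (boolP (j \in s)) => //= js; rewrite (memPn as_ _ js).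
  rewrite mulr_sumr big_seq [RHS]big_seq; apply: eq_bigr => i si.
  by rewrite big_cons eq_sym (memPn as_ _ si) mulrCA.
by rewrite H ?index_enum_uniq.
Qed.

(* Jacobi's formula *)
Lemma deriv_det (R : comNzRingType) (k : nat) (S : 'M[{poly R}]_k) :
  (\det S)^`() = \tr (map_mx deriv S *m \adj S).
Proof.
(* Product rule, one row at a time. The determinant with row i differentiated is then expanded along
   that row, whose cofactors are those of [S]. *)
transitivity (\sum_i \det (\matrix_(i', j) if i' == i then (S i' j)^`() else S i' j)).
  rewrite exchange_big /= raddf_sum /=; apply: eq_bigr => s _.
  rewrite -(rmorph_sign polyC) deriv_mulC deriv_prod mulr_sumr.
  apply: eq_bigr => i _; congr (_ * _).
  rewrite [RHS](bigD1 i) //= mxE eqxx; congr (_ * _).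
  by apply: eq_bigr => j ji; rewrite mxE (negPf ji).
rewrite /mxtrace; apply: eq_bigr => i _.
rewrite (expand_det_row _ i) mxE; apply: eq_bigr => j _.
rewrite !mxE eqxx; congr (_ * _); rewrite /cofactor; congr (_ * \det _).
apply/matrixP => a b; rewrite !mxE.
by rewrite eq_sym (negPf (neq_lift _ _)).
Qed.

(** * One-entry perturbations of Gram matrices *)

Lemma tr_delta_mx (R : pzSemiRingType) (m n : nat) (i : 'I_m) (j : 'I_n) :
  (delta_mx i j : 'M[R]_(m, n))^T = delta_mx j i.
Proof. by apply/matrixP => a b; rewrite !mxE andbC. Qed.

(** [A^T *m A] is the sum of the rank-one matrices of the rows of [A], and only row i feels the
    change. Removing that row leaves [Si], free of [e]; the new row [re] comes back through
    [det_rank1]. *)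
Lemma det_gram_perturb (R : idomainType) (n k : nat) (N : 'M[R]_k)
    (A : 'M[R]_(n, k)) (d e : R) (i : 'I_n) (j : 'I_k) :
  let Si := N + d *: (A^T *m A) - d *: ((row i A)^T *m row i A) in
  let Ae := A + e *: delta_mx i j in
  let re := row i A + e *: delta_mx 0 j in
  \det (N + d *: (Ae^T *m Ae)) = \det Si + d * (re *m \adj Si *m re^T) 0 0.
Proof.
move=> Si Ae re.
have E : Ae^T *m Ae = A^T *m A - (row i A)^T *m row i A + re^T *m re.
  rewrite /Ae /re !linearD /= !linearZ /= !tr_delta_mx.
  rewrite !mulmxDl ?mulmxDr -!scalemxAl -?scalemxAr !mul_delta_mx.
  have -> : A^T *m delta_mx i j = (row i A)^T *m delta_mx 0 j.
    by rewrite rowE trmx_mul tr_delta_mx -mulmxA mul_delta_mx.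
  have -> : delta_mx j i *m A = delta_mx j 0 *m row i A.
    by rewrite rowE mulmxA mul_delta_mx.
  by rewrite -!addrA addKr.
have -> : N + d *: (Ae^T *m Ae) = Si + (d *: re^T) *m re.
  by rewrite E -scalemxAl scalerDr scalerBr !addrA.
by rewrite det_rank1 -scalemxAr mxE.
Qed.

(** Since [Si] does not depend on the step, [F] is exactly quadratic along a single entry. The
    second difference therefore has no remainder: the constant and linear parts cancel and only the
    leading coefficient survives. *)
Lemma det_gram_second_difference (R : idomainType) (n k : nat) (N : 'M[R]_k)
    (A : 'M[R]_(n, k)) (d e : R) (i : 'I_n) (j : 'I_k) :
  let F := fun M : 'M[R]_(n, k) => \det (N + d *: (M^T *m M)) in
  let Si := N + d *: (A^T *m A) - d *: ((row i A)^T *m row i A) in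
  F (A + e *: delta_mx i j) + F (A - e *: delta_mx i j) - 2 * F A
    = 2 * e ^+ 2 * (d * (\adj Si) j j).
Proof.
move=> F Si.
have FA : F A = \det Si + d * (row i A *m \adj Si *m (row i A)^T) 0 0.
  by have := det_gram_perturb N A d 0 i j; rewrite !scale0r !addr0.
rewrite FA {FA}/F -scaleNr !det_gram_perturb -/Si.
set D := \adj Si; set r := row i A.
have E : D j j = (delta_mx 0 j *m D *m (delta_mx 0 j)^T : 'M[R]_1) 0 0.
  by rewrite tr_delta_mx -rowE -colE [RHS]mxE [RHS]mxE.
pose w : 'rV[R]_k := delta_mx 0 j.
have quad a : ((r + a *: w) *m D *m (r + a *: w)^T) 0 0
    = (r *m D *m r^T) 0 0
      + a * ((w *m D *m r^T) 0 0 + (r *m D *m w^T) 0 0)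
      + a ^+ 2 * (w *m D *m w^T) 0 0.
  have mD (x y : 'M[R]_1) : (x + y) 0 0 = x 0 0 + y 0 0 by rewrite mxE.
  have mZ b (x : 'M[R]_1) : (b *: x) 0 0 = b * x 0 0 by rewrite mxE.
  rewrite raddfD /= !mulmxDl !mulmxDr -!scalemxAl linearZ /= -!scalemxAr.
  rewrite !mD !mZ; ring.
rewrite -!/w !quad -E. ring.
Qed.

(** The trace of [\adj M] is the derivative at x = 0 of det(x I + M). Splitting off row i by
    [det_rank1] before differentiating leaves one copy of [\det SX] per row, and the quadratic forms
    in the rows add up to a single trace. *)
Lemma sum_tr_adj_gram (R : idomainType) (n k : nat) (N : 'M[R]_k)
    (A : 'M[R]_(n, k)) (d : R) :
  let S := N + d *: (A^T *m A) in
  let SX := 'X%:M + map_mx polyC S in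
  \sum_i \tr (\adj (S - d *: ((row i A)^T *m row i A))) =
  (n%:R * (\det SX)^`()
    - d *: (\tr (\adj SX *m map_mx polyC (A^T *m A)))^`()).[0].
Proof.
move=> S SX; pose AX := map_mx polyC A.
pose SXi i := SX + (- d%:P *: (row i AX)^T) *m row i AX.
have tr_at0 i : \tr (\adj (S - d *: ((row i A)^T *m row i A)))
    = ((\det (SXi i))^`()).[0].
  have -> : S - d *: ((row i A)^T *m row i A) = map_mx (horner_eval 0) (SXi i).
    rewrite {}/SXi {}/SX; move: S => S'; apply/matrixP => a b.
    rewrite !mxE !big_ord1 !mxE /horner_eval !hornerE hornerMn hornerX mul0rn.
    by rewrite add0r /= !mulNr ?mulrA.
  rewrite -map_mx_adj deriv_det.
  have -> : map_mx deriv (SXi i) = 1%:M.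
    apply/matrixP => a b; rewrite !mxE !big_ord1 !mxE !derivD derivC addr0.
    rewrite derivMn derivX !derivM !(derivN, derivC).
    by rewrite !(mul0r, mulr0, oppr0, addr0).
  by rewrite mul1mx trace_map_mx.
under eq_bigr do rewrite tr_at0 /SXi det_rank1 derivD hornerD.
rewrite big_split /= sumr_const card_ord hornerD hornerM -polyC_natr hornerC.
rewrite mulr_natl; congr (_ + _).
transitivity ((\sum_i (- d%:P * (row i AX *m \adj SX *m (row i AX)^T) 0 0))^`().[0]).
  by rewrite raddf_sum horner_sum; apply: eq_bigr => i _;
    rewrite -scalemxAr [in LHS]mxE.
rewrite -mulr_sumr mulNr derivN mul_polyC derivZ; congr ((- (_ *: _^`())).[_]).
(* By cyclicity the trace becomes that of [AX *m \adj SX *m AX^T], whose diagonal entries are the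
   quadratic forms in the rows. *)
rewrite map_mxM -map_trmx mulmxA mxtrace_mulC mulmxA /mxtrace.
by apply: eq_bigr => i _; rewrite -row_mul [LHS]mxE [RHS]mxE;
  apply: eq_bigr => l _; rewrite !mxE.
Qed.

(* With d one of the weights u - 1, u, [d ^+ 2 = (2 u - 1) d - u (u - 1)];
   this turns the weighted sum of squares into the mixed derivative. *)
Lemma weighted_gram_identity (R : idomainType) (n1 n2 k : nat)
    (G1 G2 : 'M[R]_k) (u : R) :
  let SX := 'X%:M + map_mx polyC ((u - 1) *: G1 + u *: G2) in
  let p' := (\det SX)^`() in
  let q G := (\tr (\adj SX *m map_mx polyC G))^`() in
  (u - 1) * (n1%:R * p' - (u - 1) *: q G1).[0]
    + u * (n2%:R * p' - u *: q G2).[0] =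
  ((n1%:R - k%:R + 1) * (u - 1) + (n2%:R - k%:R + 1) * u) * p'.[0]
    + u * (u - 1) * (q (G1 + G2)).[0].
Proof.
move=> SX p' q.
have qD G H : q (G + H) = q G + q H.
  by rewrite /q map_mxD mulmxDr mxtraceD derivD.
have qZ a G : q (a *: G) = a *: q G.
  by rewrite /q map_mxZ -scalemxAr mxtraceZ mul_polyC derivZ.
have tr_adj : \tr (\adj SX) = p'.
  rewrite /p' deriv_det.
  have -> : map_mx deriv SX = 1%:M.
    by apply/matrixP => a b; rewrite !mxE derivD derivC addr0 derivMn derivX.
  by rewrite mul1mx.
(* The matrix on the left is [SX - 'X%:M], and [\adj SX *m SX] is scalar, so the trace equals k p -
   X p' with p = [\det SX]. Its derivative at 0 is (k - 1) p'(0), the source of the shift by k - 1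
   in the final formula. *)
have key : ((u - 1) *: q G1 + u *: q G2).[0] = (k%:R - 1) * p'.[0].
  rewrite -!qZ -qD /q.
  have -> : map_mx polyC ((u - 1) *: G1 + u *: G2) = SX - 'X%:M.
    by rewrite /SX addrAC subrr add0r.
  rewrite mulmxBr mul_adj_mx mul_mx_scalar raddfB /= mxtraceZ mxtrace_scalar.
  rewrite tr_adj derivB derivMn derivM derivX mul1r -/p'.
  rewrite !(hornerD, hornerN, hornerM, hornerX, hornerMn) mul0r addr0.
  by rewrite mulrBl mul1r mulr_natl.
rewrite qD; move: key.
rewrite -!polyC_natr !(hornerD, hornerN, hornerM, hornerZ, hornerC).
move: (q G1).[0] (q G2).[0] p'.[0] => a b c key.
(* The factor 2u - 1 = (u - 1) + u then distributes the k - 1 from [key] over the two coefficients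
   [n1%:R] and [n2%:R]. *)
have -> : (u - 1) * (n1%:R * c - (u - 1) * a) + u * (n2%:R * c - u * b)
  = (n1%:R * (u - 1) + n2%:R * u) * c - (2 * u - 1) * ((u - 1) * a + u * b)
    + u * (u - 1) * (a + b) by ring.
by rewrite key; ring.
Qed.

(** * Moments *)

(** Unlike integrability, this condition is stable under products, which makes every monomial in the
    entries integrable. *)
Definition measurable_all_moments {d : measure_display} {T : measurableType d}
    {R : realType} (P : probability T R) (f : T -> R) : Prop :=
  measurable_fun [set: T] f /\
  forall m : nat, P.-integrable [set: T] (fun t => (f t ^+ m)%:E).

Lemma measurable_all_momentsM (d : measure_display) (T : measurableType d)
    (R : realType) (P : probability T R) (f g : T -> R) :
  measurable_all_moments P f -> measurable_all_moments P g ->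
  measurable_all_moments P (fun t => f t * g t).
Proof.
move=> [mf intf] [mg intg]; split; first exact: measurable_funM.
move=> m.
(* The dominating function: |a b| <= a^2 + b^2 with a = f^m and b = g^m. *)
have intfg : P.-integrable [set: T]
    (fun t => (f t ^+ (m * 2))%:E + (g t ^+ (m * 2))%:E)%E.
  by apply: integrableD.
apply: le_integrable intfg => //.
  by apply/measurable_EFinP; apply: measurable_funX; exact: measurable_funM.
move=> t _; rewrite -EFinD !abse_EFin lee_fin exprMn !exprM.
move: (f t ^+ m) (g t ^+ m) => a b.
rewrite [leRHS]ger0_norm ?addr_ge0 ?sqr_ge0 // normrM.
rewrite -(real_normK (num_real a)) -(real_normK (num_real b)).
have := normr_ge0 a; have := normr_ge0 b.
move: `|a| `|b| => x y; nra.
Qed.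

Lemma measurable_all_moments_prod (d : measure_display) (T : measurableType d)
    (R : realType) (P : probability T R) (E : Type) (X : E -> T -> R)
    (s : seq E) :
  (forall e, measurable_all_moments P (X e)) ->
  measurable_all_moments P (fun t => \prod_(e <- s) X e t).
Proof.
move=> mX; elim: s => [|e s IH].
  under eq_fun do rewrite big_nil.
  split; first exact: measurable_cst.
  move=> m; under eq_fun do rewrite expr1n.
  exact: finite_measure_integrable_cst.
under eq_fun do rewrite big_cons.
exact: measurable_all_momentsM.
Qed.

Lemma measurable_all_moments_integrable (d : measure_display)
    (T : measurableType d) (R : realType) (P : probability T R) (f : T -> R) :
  measurable_all_moments P f -> P.-integrable [set: T] (EFin \o f).
Proof.
by move=> [_ /(_ 1)]; under eq_fun do rewrite expr1.
Qed.

Lemma fine_expectation_sum (d : measure_display) (T : measurableType d)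
    (R : realType) (P : probability T R) (I : finType) (a : I -> R)
    (Y : I -> T -> R) :
  (forall i, P.-integrable [set: T] (EFin \o Y i)) ->
  fine 'E_P[fun t => (\sum_i a i * Y i t)%R]%E = \sum_i a i * fine 'E_P[Y i]%E.
Proof.
move=> intY; rewrite unlock.
have intaY i : P.-integrable [set: T] (EFin \o (fun t => a i * Y i t)).
  by have := integrableZl measurableT (a i) (intY i); apply: eq_integrable.
elim: (index_enum I) => [|i s IH].
  rewrite big_nil; under eq_integral do rewrite big_nil.
  by rewrite integral0.
rewrite big_cons -IH; under eq_integral do rewrite big_cons.
rewrite -[LHS]/(Rintegral _ _ _) RintegralD //.
  by rewrite RintegralZl.
have := @integrable_sum _ _ _ P setT measurableT _ s xpredT
  (fun i t => (a i * Y i t)%:E) (fun i _ => intaY i).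
by apply: eq_integrable => // t _ /=; rewrite sumEFin.
Qed.

(** An expectation depends only on the law, so that of [X] equals that of its opposite;
    integrability makes it a finite number equal to its own negative. *)
Lemma fine_expectation_symmetric (d : measure_display) (T : measurableType d)
    (R : realType) (P : probability T R) (X : {RV P >-> R}) :
  symmetric_rv X -> P.-integrable [set: T] (EFin \o X) ->
  fine 'E_P[X]%E = 0.
Proof.
move=> symX intX.
have mE : measurable_fun [set: R] (@EFin R) by exact/measurable_EFinP.
have intNX : P.-integrable [set: T] (EFin \o (\- X)).
  by have := integrableN intX.
have E : 'E_P[X]%E = 'E_P[\- X]%E.
  rewrite unlock.
  rewrite -[LHS](integral_distribution mE intX).
  rewrite -[RHS](integral_distribution (X := (\- X : {mfun T >-> R})) mE intNX).
  by apply: eq_measure_integral => A mA _; exact: symX.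
move: E; rewrite unlock => E.
suff : \int[P]_t X t = - \int[P]_t X t.
  by rewrite ?unlock /Rintegral => H; lra.
rewrite {1}/Rintegral E -[LHS]/(Rintegral _ _ _).
rewrite -[RHS]mulN1r -RintegralZl //.
by under [RHS]eq_Rintegral do rewrite mulN1r.
Qed.

Lemma fine_expectation_sqr (d : measure_display) (T : measurableType d)
    (R : realType) (P : probability T R) (X : {RV P >-> R}) :
  fine 'E_P[X]%E = 0 -> 'V_P[X]%E = 1%E ->
  fine 'E_P[fun t => (X t * X t)%R]%E = 1.
Proof.
move=> X0; rewrite /variance unlock X0 => VX.
rewrite [X in fine X](_ : _ = 1%E) // -VX; congr expectation.
by apply/funext => t /=; rewrite /cst /GRing.mul /= subr0.
Qed.

(** The pairs (X, Y) and (-X, Y) have the same joint law, namely the product of the marginals, so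
    the expectation of XY equals its own negative. *)
Lemma fine_expectation_mul_symmetric (d : measure_display)
    (T : measurableType d) (R : realType) (P : probability T R)
    (X Y : {RV P >-> R}) :
  symmetric_rv X ->
  (forall A B, measurable A -> measurable B ->
    P (X @^-1` A `&` Y @^-1` B) = (P (X @^-1` A) * P (Y @^-1` B))%E) ->
  P.-integrable [set: T] (fun t => (X t * Y t)%:E) ->
  fine 'E_P[fun t => (X t * Y t)%R]%E = 0.
Proof.
move=> symX indXY intXY.
pose NX : {mfun T >-> R} := \- X.
have mp (Z : {mfun T >-> R}) :
    measurable_fun [set: T] (fun t => (Z t, Y t)).
  by apply: measurable_fun_pair.
(* The pair (Z, Y) as one measurable map into the plane, so that its law is a [distribution]. *)
pose pk (Z : {mfun T >-> R}) : {mfun T >-> (R * R)%type} :=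
  MeasurableFun.Pack (MeasurableFun.Class
    (isMeasurableFun.Build _ _ _ _ _ (mp Z))).
(* Independence gives agreement on rectangles, which determine the product measure. *)
have law (Z : {mfun T >-> R}) : (forall A, measurable A ->
      P (Z @^-1` A) = P (X @^-1` A)) ->
    (forall A B, measurable A -> measurable B ->
      P (Z @^-1` A `&` Y @^-1` B) = (P (Z @^-1` A) * P (Y @^-1` B))%E) ->
    forall S, measurable S ->
    (distribution P X \x distribution P Y)%E S = distribution P (pk Z) S.
  move=> ZX ZY; apply: product_measure_unique => A B mA mB.
  rewrite [X in _ = (X * _)%E](_ : _ = P (Z @^-1` A)); last by rewrite ZX.
  exact: ZY.
have NXX A : measurable A -> P (NX @^-1` A) = P (X @^-1` A).
  by move=> mA; have := symX A mA.
have NXY A B : measurable A -> measurable B ->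
    P (NX @^-1` A `&` Y @^-1` B) = (P (NX @^-1` A) * P (Y @^-1` B))%E.
  move=> mA mB.
  have NA : NX @^-1` A = X @^-1` (-%R @^-1` A) by [].
  rewrite NA indXY // -[X in measurable X]setTI.
  exact: oppr_measurable.
have mf : measurable_fun [set: R * R] (fun z => (z.1 * z.2)%:E : \bar R).
  by apply/measurable_EFinP; apply: measurable_funM.
have intNXY : P.-integrable [set: T] (fun t => (NX t * Y t)%:E).
  have := integrableN intXY; apply: eq_integrable => // t _ /=.
  by rewrite mulNr.
have E : 'E_P[fun t => (X t * Y t)%R]%E = 'E_P[fun t => (NX t * Y t)%R]%E.
  rewrite unlock.
  rewrite -[LHS](integral_distribution (X := pk X) mf intXY).
  rewrite -[RHS](integral_distribution (X := pk NX) mf intNXY).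
  apply: eq_measure_integral => S mS _.
  transitivity ((distribution P X \x distribution P Y)%E S).
    exact/esym/law.
  exact: law.
suff : \int[P]_t (X t * Y t) = - \int[P]_t (X t * Y t).
  by rewrite ?unlock /Rintegral => H; lra.
move: E; rewrite unlock => E.
rewrite {1}/Rintegral E -[LHS]/(Rintegral _ _ _).
rewrite -[RHS]mulN1r -RintegralZl //.
by under [RHS]eq_Rintegral do rewrite mulN1r -mulNr.
Qed.

(** * Polynomials in small noise *)

(* The exponent of [Num.sqrt theta] is the degree in the noise [v], so that
   terms of degree at least 3 are o(theta). *)
Definition noise_polynomial {R : realType} {E : finType}
    (f : R -> (E -> R) -> R) : Prop :=
  exists (I : finType) (c : I -> R -> R) (m : I -> seq E),
    (forall i, cvg (c i theta @[theta --> 0^'+])) /\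
    forall theta v,
      f theta v = \sum_i c i theta * \prod_(e <- m i) (Num.sqrt theta * v e).

Lemma noise_polynomial_cst (R : realType) (E : finType) (c : R -> R) :
  cvg (c theta @[theta --> 0^'+]) ->
  noise_polynomial (fun theta (_ : E -> R) => c theta).
Proof.
move=> cc; exists unit, (fun=> c), (fun=> [::]); split => // theta v.
by rewrite (big_pred1 tt) => [|[]//]; rewrite big_nil mulr1.
Qed.

Lemma noise_polynomial_var (R : realType) (E : finType) (e : E) :
  noise_polynomial (fun theta (v : E -> R) => Num.sqrt theta * v e).
Proof.
exists unit, (fun _ _ => 1), (fun=> [:: e]); split.
  by move=> _; exact: is_cvg_cst.
by move=> theta v; rewrite (big_pred1 tt) => [|[]//]; rewrite big_seq1 mul1r.
Qed.

Lemma noise_polynomialD (R : realType) (E : finType)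
    (f g : R -> (E -> R) -> R) :
  noise_polynomial f -> noise_polynomial g ->
  noise_polynomial (fun theta v => f theta v + g theta v).
Proof.
move=> [I [c [m [cc fE]]]] [J [c' [m' [cc' gE]]]].
exists (I + J)%type, (fun x => match x with inl i => c i | inr j => c' j end),
  (fun x => match x with inl i => m i | inr j => m' j end).
split; first by case.
by move=> theta v; rewrite fE gE big_sumType.
Qed.

Lemma noise_polynomialM (R : realType) (E : finType)
    (f g : R -> (E -> R) -> R) :
  noise_polynomial f -> noise_polynomial g ->
  noise_polynomial (fun theta v => f theta v * g theta v).
Proof.
move=> [I [c [m [cc fE]]]] [J [c' [m' [cc' gE]]]].
exists (I * J)%type, (fun x theta => c x.1 theta * c' x.2 theta),
  (fun x => m x.1 ++ m' x.2).
split; first by move=> [i j] /=; apply: is_cvgM.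
move=> theta v; rewrite fE gE big_distrlr pair_bigA /=.
by apply: eq_bigr => -[i j] _ /=; rewrite big_cat /= mulrACA.
Qed.

Lemma noise_polynomial_sum (R : realType) (E : finType) (J : Type) (s : seq J)
    (f : J -> R -> (E -> R) -> R) :
  (forall j, noise_polynomial (f j)) ->
  noise_polynomial (fun theta v => \sum_(j <- s) f j theta v).
Proof.
move=> nf; elim: s => [|j s IH].
  under eq_fun do under eq_fun do rewrite big_nil.
  by apply: (@noise_polynomial_cst _ _ (fun=> 0)); exact: is_cvg_cst.
under eq_fun do under eq_fun do rewrite big_cons.
exact: (noise_polynomialD (nf j) IH).
Qed.

Lemma noise_polynomial_prod (R : realType) (E : finType) (J : Type) (s : seq J)
    (f : J -> R -> (E -> R) -> R) :
  (forall j, noise_polynomial (f j)) ->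
  noise_polynomial (fun theta v => \prod_(j <- s) f j theta v).
Proof.
move=> nf; elim: s => [|j s IH].
  under eq_fun do under eq_fun do rewrite big_nil.
  by apply: (@noise_polynomial_cst _ _ (fun=> 1)); exact: is_cvg_cst.
under eq_fun do under eq_fun do rewrite big_cons.
exact: (noise_polynomialM (nf j) IH).
Qed.

Lemma noise_polynomial_det (R : realType) (E : finType) (k : nat)
    (M : R -> (E -> R) -> 'M[R]_k) :
  (forall i j, noise_polynomial (fun theta v => M theta v i j)) ->
  noise_polynomial (fun theta v => \det (M theta v)).
Proof.
move=> nM; rewrite /determinant; apply: (@noise_polynomial_sum _ _ _ _
  (fun (s : {perm 'I_k}) theta v => (-1) ^+ odd_perm s * \prod_i M theta v i (s i))) => s.
apply: noise_polynomialM.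
  by apply: (@noise_polynomial_cst _ _ (fun=> (-1) ^+ odd_perm s)); exact: is_cvg_cst.
by apply: (@noise_polynomial_prod _ _ _ _ (fun i theta v => M theta v i (s i))).
Qed.

Lemma noise_polynomial_mulmx (R : realType) (E : finType) (m n p : nat)
    (M : R -> (E -> R) -> 'M[R]_(m, n)) (N : R -> (E -> R) -> 'M[R]_(n, p)) :
  (forall i j, noise_polynomial (fun theta v => M theta v i j)) ->
  (forall i j, noise_polynomial (fun theta v => N theta v i j)) ->
  forall i j, noise_polynomial (fun theta v => (M theta v *m N theta v) i j).
Proof.
move=> nM nN i j; under eq_fun do under eq_fun do rewrite mxE.
by apply: noise_polynomial_sum => l; exact: noise_polynomialM.
Qed.

(** * Second differences along the unit vectors *)

Definition unit_noise {R : realType} {E : finType} (e : E) : E -> R :=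
  fun e' => (e' == e)%:R.

Lemma sum_unit_noise_mul (R : realType) (E : finType) (a b : E) :
  \sum_g unit_noise g a * unit_noise g b = (a == b)%:R :> R.
Proof.
rewrite (bigD1 a) //= /unit_noise eqxx mul1r big1 ?addr0 1?eq_sym // => g ga.
by rewrite eq_sym (negPf ga) mul0r.
Qed.

(* Noise with mean 0 and identity covariance agrees to second order with
   the signed unit vectors. *)
Lemma expectation_second_difference (R : realType) (d : measure_display)
    (T : measurableType d) (P : probability T R) (E : finType)
    (X : E -> T -> R) (f : R -> (E -> R) -> R) :
  (forall e, measurable_all_moments P (X e)) ->
  (forall e, fine 'E_P[X e]%E = 0) ->
  (forall a b, fine 'E_P[fun t => (X a t * X b t)%R]%E = (a == b)%:R) ->
  noise_polynomial f ->
  theta^-1 * (fine 'E_P[fun t => f theta (X^~ t)]%E - f theta (fun=> 0)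
    - 2^-1 * \sum_e (f theta (unit_noise e) + f theta (\- unit_noise e)
                     - 2 * f theta (fun=> 0)))
    @[theta --> 0^'+] --> (0 : R).
Proof.
move=> mX X1 X2 [I [c [m [cc fE]]]].
pose mu (s : seq E) := fine 'E_P[fun t => (\prod_(e <- s) X e t)%R]%E.
pose mon (v : E -> R) (s : seq E) := \prod_(e <- s) v e.
(* The error on the monomial [s] when its expectation is replaced by its value at 0 plus half the
   sum of its second differences. It is free of [theta], because the powers of [Num.sqrt theta]
   factor out of each monomial. *)
pose kappa s := mu s - mon (fun=> 0) s
  - 2^-1 * \sum_e (mon (unit_noise e) s + mon (\- unit_noise e) s
                   - 2 * mon (fun=> 0) s).
have monE theta v s :
    \prod_(e <- s) (Num.sqrt theta * v e) = Num.sqrt theta ^+ size s * mon v s.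
  rewrite /mon; elim: s => [|e s IH]; first by rewrite !big_nil mulr1.
  by rewrite !big_cons IH exprS; ring.
have fE' theta v : f theta v
    = \sum_i (c i theta * Num.sqrt theta ^+ size (m i)) * mon v (m i).
  by rewrite fE; apply: eq_bigr => i _; rewrite monE mulrA.
have EfE theta : fine 'E_P[fun t => f theta (X^~ t)]%E
    = \sum_i (c i theta * Num.sqrt theta ^+ size (m i)) * mu (m i).
  under eq_fun do rewrite fE'.
  rewrite fine_expectation_sum // => i.
  by apply: measurable_all_moments_integrable;
    exact: measurable_all_moments_prod.
(* Degree 0 is exact; in degree 1 the mean is 0 and opposite signs cancel; in degree 2 the unit
   vectors reproduce the identity covariance. *)
have kappa0 s : (size s <= 2)%N -> kappa s = 0.
  case: s => [|a [|b []]] // _; rewrite /kappa /mu /mon.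
  - under eq_fun do rewrite big_nil.
    rewrite -[X in 'E_P[X]%E]/(cst 1) expectation_cst big_nil subrr.
    by rewrite big1 ?mulr0 ?subr0 // => e _; rewrite !big_nil; ring.
  - under eq_fun do rewrite big_seq1.
    rewrite X1 big_seq1 big1 ?mulr0 ?subr0 // => e _; rewrite !big_seq1 /=; ring.
  - under eq_fun do rewrite big_cons big_seq1.
    rewrite X2 !big_cons big_nil mul0r subr0.
    rewrite (eq_bigr (fun g => 2 * (unit_noise g a * unit_noise g b))).
      by rewrite -mulr_sumr sum_unit_noise_mul mulrA mulVf ?mul1r ?subrr.
    by move=> g _; rewrite !big_cons !big_nil /=; ring.
pose term i theta :=
  theta^-1 * (c i theta * Num.sqrt theta ^+ size (m i) * kappa (m i)).
have -> : (fun theta => theta^-1 *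
    (fine 'E_P[fun t => f theta (X^~ t)]%E - f theta (fun=> 0)
    - 2^-1 * \sum_e (f theta (unit_noise e) + f theta (\- unit_noise e)
                     - 2 * f theta (fun=> 0)))) =
    (fun theta => \sum_i term i theta).
  apply/funext => theta; rewrite EfE -mulr_sumr; congr (_ * _).
  have -> : \sum_e (f theta (unit_noise e) + f theta (\- unit_noise e)
                     - 2 * f theta (fun=> 0))
    = \sum_i c i theta * Num.sqrt theta ^+ size (m i) *
       \sum_e (mon (unit_noise e) (m i) + mon (\- unit_noise e) (m i)
                   - 2 * mon (fun=> 0) (m i)).
    under [RHS]eq_bigr do rewrite mulr_sumr.
    rewrite exchange_big; apply: eq_bigr => e _.
    rewrite !fE' mulr_sumr -big_split -sumrB /=.
    by apply: eq_bigr => i _; ring.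
  rewrite fE' mulr_sumr -!sumrB; apply: eq_bigr => i _.
  by rewrite /kappa; ring.
suff H i : term i theta @[theta --> 0^'+] --> (0 : R).
  rewrite -[X in _ --> X](_ : \sum_(i : I) (0 : R) = 0); last by rewrite big1.
  apply: (@cvg_big R I +%R 0 xpredT _ _ _ (index_enum I) term (fun=> 0)) => //.
  exact: add_continuous.
have [/kappa0 k0|] := leqP (size (m i)) 2.
  rewrite /term k0; under eq_fun do rewrite mulr0 mulr0.
  exact: cvg_cst.
move=> size3; pose n := (size (m i) - 3)%N.
have sqrt0 : Num.sqrt theta @[theta --> (0 : R)^'+] --> (0 : R).
  apply: cvg_at_right_filter.
  by have := @sqrt_continuous R 0; rewrite /continuous_at sqrtr0.
(* For theta > 0 this is [term i theta]: dividing the power n + 3 of [Num.sqrt theta] by theta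
   leaves the power n + 1, which tends to 0. *)
have : (c i theta * kappa (m i)) * (Num.sqrt theta * Num.sqrt theta ^+ n)
    @[theta --> 0^'+] --> lim (c i theta @[theta --> 0^'+]) * kappa (m i) * (0 * 0 ^+ n).
  apply: cvgM; first by apply: cvgM; [exact: cc|exact: cvg_cst].
  apply: cvgM => //.
  exact: (continuous_cvg _ (@exprn_continuous R n 0) sqrt0).
rewrite mul0r mulr0; apply: cvg_trans; apply: near_eq_cvg.
near=> theta.
have theta0 : 0 < theta by near: theta; exact: nbhs_right_gt.
rewrite /term -[in RHS](subnK size3) -/n.
have -> : Num.sqrt theta ^+ (n + 3) = theta * (Num.sqrt theta * Num.sqrt theta ^+ n).
  by rewrite addnC exprD exprSr -mulrA (sqr_sqrtr (ltW theta0)).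
by field; rewrite gt_eqF.
Unshelve. all: by end_near. Qed.

(** * Limits and derivatives of determinants *)

Lemma cvg_det (R : realType) (k : nat) (M : R -> 'M[R]_k) (L : 'M[R]_k)
    (F : set_system R) : Filter F ->
  (forall i j, M x i j @[x --> F] --> L i j) ->
  \det (M x) @[x --> F] --> \det L.
Proof.
move=> FF ML; rewrite /determinant.
apply: (@cvg_big R _ +%R 0 xpredT _ _ _ _
  (fun (s : {perm 'I_k}) x => (-1) ^+ odd_perm s * \prod_i M x i (s i))
  (fun s => (-1) ^+ odd_perm s * \prod_i L i (s i))) => [|s _].
  exact: add_continuous.
apply: cvgM; first exact: cvg_cst.
apply: (@cvg_big R _ *%R 1 xpredT _ _ _ _
  (fun i x => M x i (s i)) (fun i => L i (s i))) => [|i _]; last exact: ML.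
exact: mul_continuous.
Qed.

Lemma cvg_tr_adj (R : realType) (k : nat) (M : R -> 'M[R]_k) (L : 'M[R]_k)
    (F : set_system R) : Filter F ->
  (forall i j, M x i j @[x --> F] --> L i j) ->
  \tr (\adj (M x)) @[x --> F] --> \tr (\adj L).
Proof.
move=> FF ML; rewrite /mxtrace.
apply: (@cvg_big R _ +%R 0 xpredT _ _ _ _
  (fun i x => (\adj (M x)) i i) (fun i => (\adj L) i i)) => [|i _].
  exact: add_continuous.
under eq_fun do rewrite mxE; rewrite mxE.
apply: cvgM; first exact: cvg_cst.
by apply: cvg_det => a b; under eq_fun do rewrite !mxE; rewrite !mxE; apply: ML.
Qed.

Lemma derive1_horner (R : realType) (p : {poly R}) (x : R) :
  derive1 (horner p) x = p^`().[x].
Proof. by rewrite derive1E derive_val. Qed.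

(** Makes the determinant a genuine polynomial in [u], so that analytic derivatives become formal
    ones and Jacobi's formula applies. *)
Lemma horner_det_affine (R : comNzRingType) (k : nat) (C G : 'M[R]_k) (u : R) :
  \det (C + u *: G) = (\det (map_mx polyC C + 'X *: map_mx polyC G)).[u].
Proof.
rewrite -[RHS]/(horner_eval u _) -det_map_mx; congr (\det _).
by apply/matrixP => i j; rewrite !mxE /= /horner_eval !hornerE.
Qed.

Lemma horner_tr_adj_affine (R : comNzRingType) (k : nat) (C G H : 'M[R]_k)
    (u : R) :
  \tr (\adj (C + u *: G) *m H) =
  (\tr (\adj (map_mx polyC C + 'X *: map_mx polyC G) *m map_mx polyC H)).[u].
Proof.
rewrite -[RHS]/(horner_eval u _) -trace_map_mx map_mxM map_mx_adj.
congr (\tr (\adj _ *m _)).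
  by apply/matrixP => i j; rewrite !mxE /= /horner_eval !hornerE.
by apply/matrixP => i j; rewrite !mxE /= /horner_eval !hornerE.
Qed.

Lemma deriv_det_affine (R : comNzRingType) (k : nat) (C G : 'M[R]_k) (u : R) :
  (\det (map_mx polyC C + 'X *: map_mx polyC G))^`().[u]
  = \tr (\adj (C + u *: G) *m G).
Proof.
rewrite deriv_det mxtrace_mulC horner_tr_adj_affine.
congr ((\tr (_ *m _)).[_]).
apply/matrixP => i j; rewrite !mxE derivD derivM !derivC derivX.
by rewrite mulr0 addr0 mul1r add0r.
Qed.

Lemma cvg_right_derivative (R : realType) (f : R -> R) (l : R) :
  is_right_derivative f 0 l -> f e @[e --> 0^'+] --> f 0.
Proof.
move=> fl.
have : f 0 + e * (e^-1 * (f (0 + e) - f 0)) @[e --> 0^'+] --> f 0 + 0 * l.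
  apply: cvgD; first exact: cvg_cst.
  by apply: cvgM => //; apply: cvg_at_right_filter; exact: cvg_id.
rewrite mul0r addr0; apply: cvg_trans; apply: near_eq_cvg.
near=> e.
have e0 : 0 < e by near: e; exact: nbhs_right_gt.
by rewrite add0r mulrA mulfV ?gt_eqF // mul1r addrC subrK.
Unshelve. all: by end_near. Qed.

(** A one-sided chain rule. As [f 0] is a root, p = r (X - f 0), so the quotient is [r.[f e]] times
    the difference quotient of [f], and r and p' agree at [f 0]. *)
Lemma cvg_horner_right_derivative (R : realType) (p : {poly R}) (f : R -> R)
    (l : R) :
  is_right_derivative f 0 l -> p.[f 0] = 0 ->
  e^-1 * p.[f e] @[e --> 0^'+] --> p^`().[f 0] * l.
Proof.
move=> fl p0.
have /factor_theorem[r pE] : root p (f 0) by rewrite /root p0.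
have f0 := cvg_right_derivative fl.
have -> : p^`().[f 0] = r.[f 0].
  by rewrite pE derivM derivXsubC !hornerE subrr mulr0 add0r.
have : r.[f e] * (e^-1 * (f (0 + e) - f 0)) @[e --> 0^'+] --> r.[f 0] * l.
  by apply: cvgM => //; exact: (continuous_cvg _ (@continuous_horner R r _) f0).
apply: cvg_trans; apply: near_eq_cvg; apply: nearW => e.
by rewrite /= pE add0r hornerM hornerXsubC mulrCA.
Qed.


(** * The pencil *)

Definition pencil {R : realType} {n1 n2 k : nat} (A : 'M[R]_(n1, k))
    (B : 'M[R]_(n2, k)) (u : R) : 'M[R]_k :=
  (u - 1) *: (A^T *m A) + u *: (B^T *m B).

Lemma pencil_affine (R : realType) (n1 n2 k : nat) (A : 'M[R]_(n1, k))
    (B : 'M[R]_(n2, k)) (x u : R) :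
  x%:M + pencil A B u
  = (x%:M - A^T *m A) + u *: (A^T *m A + B^T *m B).
Proof.
rewrite /pencil; move: (A^T *m A) (B^T *m B) => G H.
by apply/matrixP => i j; rewrite !mxE; ring.
Qed.

(** * The noiseless function h and its partial derivatives *)

Lemma htilde_theta0 (d : measure_display) (T : measurableType d)
    (R : realType) (P : probability T R) (k n1 n2 : nat)
    (A : 'M[R]_(n1, k)) (B : 'M[R]_(n2, k))
    (X1 : 'I_n1 -> 'I_k -> {RV P >-> R}) (X2 : 'I_n2 -> 'I_k -> {RV P >-> R}) :
  (fun x u => htilde A B X1 X2 x u 0) = (fun x u => \det (x%:M + pencil A B u)).
Proof.
apply/funext => x; apply/funext => u.
rewrite /htilde /perturb_mx sqrtr0.
under eq_fun do rewrite /= !scale0r !addr0 -addrA.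
by rewrite -[X in 'E_P[X]%E]/(cst _) expectation_cst.
Qed.

Lemma partial1_det_pencil (R : realType) (n1 n2 k : nat) (A : 'M[R]_(n1, k))
    (B : 'M[R]_(n2, k)) (x u : R) :
  partial1 (fun x u => \det (x%:M + pencil A B u)) x u
  = (\det ('X%:M + map_mx polyC (pencil A B u)))^`().[x].
Proof.
rewrite /partial1 -derive1_horner; congr (derive1 _ _); apply/funext => y.
rewrite addrC -scalemx1 horner_det_affine; congr ((\det _).[_]).
by rewrite map_mx1 scalemx1 addrC.
Qed.

Lemma partial2_det_pencil (R : realType) (n1 n2 k : nat) (A : 'M[R]_(n1, k))
    (B : 'M[R]_(n2, k)) :
  partial2 (fun x u => \det (x%:M + pencil A B u))
  = (fun x u => \tr (\adj (x%:M + pencil A B u) *m (A^T *m A + B^T *m B))).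
Proof.
apply/funext => x; apply/funext => u.
rewrite pencil_affine -deriv_det_affine /partial2 -derive1_horner.
congr (derive1 _ _); apply/funext => v.
by rewrite pencil_affine horner_det_affine.
Qed.

Lemma partial12_det_pencil (R : realType) (n1 n2 k : nat) (A : 'M[R]_(n1, k))
    (B : 'M[R]_(n2, k)) (x u : R) :
  partial1 (partial2 (fun x u => \det (x%:M + pencil A B u))) x u
  = (\tr (\adj ('X%:M + map_mx polyC (pencil A B u))
          *m map_mx polyC (A^T *m A + B^T *m B)))^`().[x].
Proof.
rewrite partial2_det_pencil /partial1 -derive1_horner.
congr (derive1 _ _); apply/funext => y.
rewrite addrC -scalemx1 horner_tr_adj_affine; congr ((\tr (\adj _ *m _)).[_]).
by rewrite map_mx1 scalemx1 addrC.
Qed.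

(* Half the Laplacian of [\det (pencil A B u)] in the entries of A and B. *)
Definition half_laplacian {R : realType} {n1 n2 k : nat} (A : 'M[R]_(n1, k))
    (B : 'M[R]_(n2, k)) (u : R) : R :=
  (u - 1) * (\sum_i \tr (\adj (pencil A B u
                               - (u - 1) *: ((row i A)^T *m row i A))))
  + u * (\sum_i \tr (\adj (pencil A B u - u *: ((row i B)^T *m row i B)))).

Lemma half_laplacianE (R : realType) (n1 n2 k : nat) (A : 'M[R]_(n1, k))
    (B : 'M[R]_(n2, k)) (u : R) :
  let h := fun x u => \det (x%:M + pencil A B u) in
  half_laplacian A B u =
  ((n1%:R - k%:R + 1) * (u - 1) + (n2%:R - k%:R + 1) * u) * partial1 h 0 u
  + u * (u - 1) * partial1 (partial2 h) 0 u.
Proof.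
move=> h; rewrite partial1_det_pencil partial12_det_pencil.
rewrite -weighted_gram_identity /half_laplacian.
have pencilC : pencil A B u = u *: (B^T *m B) + (u - 1) *: (A^T *m A).
  by rewrite /pencil addrC.
(* [sum_tr_adj_gram] wants the Gram matrix of the removed row as last summand, so the two terms of
   the pencil are swapped for the rows of [A] only. *)
by rewrite {1}pencilC /pencil !sum_tr_adj_gram [u *: _ + _]addrC.
Qed.

(** Needed because the expansion is made at the moving point [wt theta], not at its limit [w]. *)
Lemma cvg_half_laplacian (R : realType) (n1 n2 k : nat) (A : 'M[R]_(n1, k))
    (B : 'M[R]_(n2, k)) (f : R -> R) (l : R) (F : set_system R) : Filter F ->
  f x @[x --> F] --> l ->
  half_laplacian A B (f x) @[x --> F] --> half_laplacian A B l.
Proof.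
move=> FF fl.
have f1 : f x - 1 @[x --> F] --> l - 1 by apply: cvgB => //; exact: cvg_cst.
have cp i j : pencil A B (f x) i j @[x --> F] --> pencil A B l i j.
  rewrite /pencil; under eq_fun do rewrite !mxE; rewrite !mxE.
  by apply: cvgD; (apply: cvgM; [|exact: cvg_cst]).
have ct (n : nat) (M : 'M[R]_(n, k)) (g : R -> R) (m : R) :
    g x @[x --> F] --> m ->
    \sum_i \tr (\adj (pencil A B (f x) - g x *: ((row i M)^T *m row i M)))
      @[x --> F] -->
    \sum_i \tr (\adj (pencil A B l - m *: ((row i M)^T *m row i M))).
  move=> gm; apply: (@cvg_big R _ +%R 0 xpredT _ _ _ _
    (fun i x => \tr (\adj (pencil A B (f x) - g x *: ((row i M)^T *m row i M))))
    (fun i => \tr (\adj (pencil A B l - m *: ((row i M)^T *m row i M)))))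
    => [|i _]; first exact: add_continuous.
  apply: cvg_tr_adj => a b.
  have mxB (C D : 'M[R]_k) : (C - D) a b = C a b - D a b by rewrite !mxE.
  have mxZ c (C : 'M[R]_k) : (c *: C) a b = c * C a b by rewrite mxE.
  under eq_fun do rewrite mxB mxZ; rewrite mxB mxZ.
  by apply: cvgB => //; apply: cvgM => //; exact: cvg_cst.
by apply: cvgD; apply: cvgM => //; exact: ct.
Qed.

(** * The pencil of the perturbed matrices *)

(** [perturb_mx] with the noise as an argument [v], so that unit vectors can replace the random
    entries. The map [idx] places both matrices in one common noise vector. *)
Definition noisy_mx {R : realType} {E : Type} {n k : nat} (A : 'M[R]_(n, k))
    (idx : 'I_n * 'I_k -> E) (theta : R) (v : E -> R) : 'M[R]_(n, k) :=
  A + \matrix_(i, j) (Num.sqrt theta * v (idx (i, j))).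

(** The weight [f theta] will be the moving root, which is why the coefficients of a
    [noise_polynomial] may vary with [theta] as long as they converge. *)
Lemma noise_polynomial_det_pencil (R : realType) (n1 n2 k : nat) (E : finType)
    (A : 'M[R]_(n1, k)) (B : 'M[R]_(n2, k))
    (idx1 : 'I_n1 * 'I_k -> E) (idx2 : 'I_n2 * 'I_k -> E) (f : R -> R) :
  cvg (f theta @[theta --> 0^'+]) ->
  noise_polynomial (fun theta v =>
    \det (pencil (noisy_mx A idx1 theta v) (noisy_mx B idx2 theta v) (f theta))).
Proof.
move=> cf; apply: noise_polynomial_det => a b.
have nm n (M : 'M[R]_(n, k)) idx i j :
    noise_polynomial (fun theta (v : E -> R) => noisy_mx M idx theta v i j).
  under eq_fun do under eq_fun do rewrite !mxE.
  apply: noise_polynomialD; last exact: noise_polynomial_var.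
  by apply: (@noise_polynomial_cst _ _ (fun=> M i j)); exact: is_cvg_cst.
have ng n (M : 'M[R]_(n, k)) idx i j :
    noise_polynomial (fun theta (v : E -> R) =>
      ((noisy_mx M idx theta v)^T *m noisy_mx M idx theta v) i j).
  apply: noise_polynomial_mulmx => // l m.
  by under eq_fun do under eq_fun do rewrite mxE.
have mxD (C D : 'M[R]_k) : (C + D) a b = C a b + D a b by rewrite !mxE.
have mxZ c (C : 'M[R]_k) : (c *: C) a b = c * C a b by rewrite mxE.
under eq_fun do under eq_fun do rewrite mxD !mxZ.
apply: noise_polynomialD; apply: noise_polynomialM; try exact: ng.
  by apply: (@noise_polynomial_cst _ _ (fun theta => f theta - 1));
    apply: is_cvgB => //; exact: is_cvg_cst.
exact: noise_polynomial_cst.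
Qed.

Lemma noisy_mx_unit (R : realType) (E : finType) (n k : nat)
    (A : 'M[R]_(n, k)) (idx : 'I_n * 'I_k -> E) (theta : R) (i : 'I_n)
    (j : 'I_k) : injective idx ->
  noisy_mx A idx theta (unit_noise (idx (i, j)))
    = A + Num.sqrt theta *: delta_mx i j.
Proof.
move=> idxI; congr (A + _); apply/matrixP => a b.
by rewrite !mxE /unit_noise /= (inj_eq idxI) xpair_eqE.
Qed.

Lemma noisy_mxN_unit (R : realType) (E : finType) (n k : nat)
    (A : 'M[R]_(n, k)) (idx : 'I_n * 'I_k -> E) (theta : R) (i : 'I_n)
    (j : 'I_k) : injective idx ->
  noisy_mx A idx theta (\- unit_noise (idx (i, j)))
    = A - Num.sqrt theta *: delta_mx i j.
Proof.
move=> idxI; congr (A + _); apply/matrixP => a b.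
by rewrite !mxE /unit_noise /= (inj_eq idxI) xpair_eqE mulrN.
Qed.

Lemma noisy_mx0 (R : realType) (E : finType) (n k : nat)
    (A : 'M[R]_(n, k)) (idx : 'I_n * 'I_k -> E) (theta : R) (v : E -> R) :
  (forall ij, v (idx ij) = 0) -> noisy_mx A idx theta v = A.
Proof.
move=> v0; rewrite -[RHS]addr0; congr (A + _); apply/matrixP => a b.
by rewrite !mxE v0 mulr0.
Qed.

(** Each entry contributes an exact second difference with step [Num.sqrt theta], whose square is
    [theta]; summing over the columns of a row turns diagonal adjugate entries into a trace. *)
Lemma sum_second_difference_det_pencil (R : realType) (n1 n2 k : nat)
    (A : 'M[R]_(n1, k)) (B : 'M[R]_(n2, k)) (theta u : R) :
  let f v := \det (pencil (noisy_mx A inl theta v) (noisy_mx B inr theta v) u) in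
  0 <= theta ->
  2^-1 * \sum_(e : 'I_n1 * 'I_k + 'I_n2 * 'I_k)
    (f (unit_noise e) + f (\- unit_noise e) - 2 * f (fun=> 0))
  = theta * half_laplacian A B u.
Proof.
move=> f theta0.
have inlI : injective (@inl ('I_n1 * 'I_k) ('I_n2 * 'I_k)) by move=> x y [].
have inrI : injective (@inr ('I_n1 * 'I_k) ('I_n2 * 'I_k)) by move=> x y [].
have f0 : f (fun=> 0) = \det (pencil A B u) by rewrite /f !noisy_mx0.
have half_sum n (a : R) (M : 'I_n -> 'M[R]_k) :
    2^-1 * (\sum_i \sum_j 2 * theta * (a * M i j j))
    = theta * (a * \sum_i \tr (M i)).
  rewrite !mulr_sumr; apply: eq_bigr => i _.
  rewrite /mxtrace !mulr_sumr; apply: eq_bigr => j _.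
  by rewrite !mulrA mulVf ?mul1r.
rewrite big_sumType /= /half_laplacian !mulrDr; congr (_ + _).
- rewrite -(pair_bigA _ (fun i j => f (unit_noise (inl (i, j)))
    + f (\- unit_noise (inl (i, j))) - 2 * f (fun=> 0))) /=.
  rewrite -half_sum; congr (_ * _); apply: eq_bigr => i _; apply: eq_bigr => j _.
  rewrite f0 /f noisy_mx_unit // noisy_mxN_unit //.
  have -> : noisy_mx B inr theta (unit_noise (inl (i, j))) = B.
    exact: noisy_mx0.
  have -> : noisy_mx B inr theta (\- unit_noise (inl (i, j))) = B.
    by apply: noisy_mx0 => ij; rewrite /= oppr0.
  rewrite /pencil ![_ + u *: _]addrC det_gram_second_difference.
  by rewrite sqr_sqrtr.
- rewrite -(pair_bigA _ (fun i j => f (unit_noise (inr (i, j)))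
    + f (\- unit_noise (inr (i, j))) - 2 * f (fun=> 0))) /=.
  rewrite -half_sum; congr (_ * _); apply: eq_bigr => i _; apply: eq_bigr => j _.
  rewrite f0 /f noisy_mx_unit // noisy_mxN_unit //.
  have -> : noisy_mx A inl theta (unit_noise (inr (i, j))) = A.
    exact: noisy_mx0.
  have -> : noisy_mx A inl theta (\- unit_noise (inr (i, j))) = A.
    by apply: noisy_mx0 => ij; rewrite /= oppr0.
  rewrite /pencil det_gram_second_difference.
  by rewrite sqr_sqrtr.
Qed.

Lemma htilde_noisy (d : measure_display) (T : measurableType d)
    (R : realType) (P : probability T R) (k n1 n2 : nat)
    (A : 'M[R]_(n1, k)) (B : 'M[R]_(n2, k))
    (X1 : 'I_n1 -> 'I_k -> {RV P >-> R}) (X2 : 'I_n2 -> 'I_k -> {RV P >-> R})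
    (u theta : R) :
  htilde A B X1 X2 0 u theta = fine 'E_P[fun t =>
    \det (pencil (noisy_mx A inl theta (fun e => all_entries X1 X2 e t))
                 (noisy_mx B inr theta (fun e => all_entries X1 X2 e t)) u)]%E.
Proof.
rewrite /htilde; congr (fine 'E_P[_]%E); apply/funext => t /=.
have perturbE n (M : 'M[R]_(n, k)) (X : 'I_n -> 'I_k -> {RV P >-> R}) :
    perturb_mx M X theta t
    = M + \matrix_(i, j) (Num.sqrt theta * X i j t).
  by congr (M + _); apply/matrixP => i j; rewrite !mxE.
by rewrite !perturbE raddf0 add0r.
Qed.

Lemma mutually_independent2 (d : measure_display) (T : measurableType d)
    (R : realType) (P : probability T R) (I : finType)
    (X : I -> {RV P >-> R}) (a b : I) (E F : set R) :
  mutually_independent X -> a != b -> measurable E -> measurable F ->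
  P (X a @^-1` E `&` X b @^-1` F) = (P (X a @^-1` E) * P (X b @^-1` F))%E.
Proof.
move=> indX ab mE mF.
have ba : b == a = false by rewrite eq_sym (negPf ab).
pose G i := if i == a then E else F.
have := indX [set a; b]%SET G.
rewrite (big_setD1 a) /= ?set21 // setU1K ?inE // big_set1 /G eqxx ba => <-.
  congr (P _); apply/seteqP; split => t /=.
    move=> [Et Ft] i; rewrite !inE => /orP[] /eqP ->; first by rewrite eqxx.
    by rewrite ba.
  move=> H; split; first by have := H a (set21 a b); rewrite eqxx.
  by have := H b (set22 a b); rewrite ba.
by move=> i _; case: ifP.
Qed.

(** * Passage to the limit theta -> 0+ *)

Theorem mainTheorem1 (R : realType) (d : measure_display)
    (T : measurableType d) (P : probability T R) (k n1 n2 : nat)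
    (k_ge1 : (1 <= k)%N) (n1_ge1 : (1 <= n1)%N) (n2_ge1 : (1 <= n2)%N)
    (A : 'M[R]_(n1, k)) (B : 'M[R]_(n2, k))
    (X1 : 'I_n1 -> 'I_k -> {RV P >-> R}) (X2 : 'I_n2 -> 'I_k -> {RV P >-> R})
    (X_indep : mutually_independent (all_entries X1 X2))
    (X_ident : forall e f,
      same_distribution (all_entries X1 X2 e) (all_entries X1 X2 f))
    (X_sym : forall e, symmetric_rv (all_entries X1 X2 e))
    (X_var : forall e, ('V_P[all_entries X1 X2 e] = 1)%E)
    (X_mom : forall e, finite_moments (all_entries X1 X2 e))
    (eps : R) (eps_gt0 : 0 < eps) (wt : R -> R) (w' : R)
    (wt_derivable : forall theta : R, 0 < theta < eps -> derivable wt theta 1)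
    (wt_derivable0 : is_right_derivative wt 0 w')
    (wt_root : forall theta : R, 0 <= theta < eps ->
      htilde A B X1 X2 0 (wt theta) theta = 0) :
  let h := fun x u => htilde A B X1 X2 x u 0 in
  let h1 := partial1 h in
  let h2 := partial2 h in
  let h12 := partial1 (partial2 h) in
  let w := wt 0 in
  h1 0 w != 0 ->
  w' * (h2 0 w / h1 0 w) =
    - (n1%:R - k%:R + 1) * (w - 1) - (n2%:R - k%:R + 1) * w
    - w * (w - 1) * (h12 0 w / h1 0 w).
Proof.
move=> h h1 h2 h12 w h1w.
pose X e := all_entries X1 X2 e : T -> R.
have mX e : measurable_all_moments P (X e).
  by split; [exact: measurable_funPT|exact: X_mom].
have EX e : fine 'E_P[X e]%E = 0.
  apply: fine_expectation_symmetric; first exact: X_sym.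
  exact: (measurable_all_moments_integrable (mX e)).
have EXX a b : fine 'E_P[fun t => (X a t * X b t)%R]%E = (a == b)%:R.
  have [<-|ab] := eqVneq a b; first exact: (fine_expectation_sqr (EX a) (X_var a)).
  apply: fine_expectation_mul_symmetric; first exact: X_sym.
    by move=> E F; exact: mutually_independent2.
  by have := measurable_all_moments_integrable (measurable_all_momentsM (mX a) (mX b)).
have wt_cvg : wt theta @[theta --> 0^'+] --> w.
  exact: cvg_right_derivative wt_derivable0.
have hE : h = (fun x u => \det (x%:M + pencil A B u)) by exact: htilde_theta0.
(* The function u -> h(0, u) as a polynomial, to be composed with [wt]. *)
pose p : {poly R} := \det (map_mx polyC (0%:M - A^T *m A)
                           + 'X *: map_mx polyC (A^T *m A + B^T *m B)).
have pE u : p.[u] = h 0 u by rewrite hE pencil_affine horner_det_affine.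
have p'E : p^`().[w] = h2 0 w.
  rewrite /h2 hE partial2_det_pencil pencil_affine.
  exact: deriv_det_affine.
have p0 : p.[wt 0] = 0.
  by rewrite pE; apply: wt_root; rewrite lexx eps_gt0.
have cvg_p := cvg_horner_right_derivative wt_derivable0 p0.
have cvg_c : half_laplacian A B (wt theta) @[theta --> 0^'+]
    --> half_laplacian A B w by exact: cvg_half_laplacian.
(* The weight is already the moving root, so with the random entries as noise the expectation is
   [htilde] at [wt theta], zero by [wt_root]. *)
pose f theta v :=
  \det (pencil (noisy_mx A inl theta v) (noisy_mx B inr theta v) (wt theta)).
have nf : noise_polynomial f.
  by apply: noise_polynomial_det_pencil; apply/cvg_ex; exists w.
have cvg_E := expectation_second_difference mX EX EXX nf.
have total : h2 0 w * w' + half_laplacian A B w = 0.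
  rewrite -[LHS]add0r addrA -p'E.
  have FF : Filter ((0 : R)^'+) by exact: at_right_proper_filter.
  (* Three limits are added: the scaled expansion error, p(wt(theta))/theta, and L(wt(theta)). For
     small theta > 0 the sum is identically 0, since the error is (0 - p - theta L)/theta;
     uniqueness of limits gives [total]. *)
  have cvg_sum := @cvgD _ _ _ _ FF _ _ _ _ (@cvgD _ _ _ _ FF _ _ _ _ cvg_E cvg_p) cvg_c.
  have c0 : (0 : R) @[theta --> (0 : R)^'+] --> (0 : R) by exact: cvg_cst.
  have c1 : (0 : R) @[theta --> (0 : R)^'+]
      --> 0 + p^`().[wt 0] * w' + half_laplacian A B w; last first.
    exact: (cvg_unique (@norm_hausdorff R R) c1 c0).
  apply: (cvg_trans _ cvg_sum); apply: near_eq_cvg.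
  near=> theta.
  have theta_gt0 : 0 < theta by near: theta; exact: nbhs_right_gt.
  have theta_lt : theta < eps by near: theta; exact: nbhs_right_lt.
  have Ef : fine 'E_P[fun t => f theta (X^~ t)]%E = 0.
    by rewrite -htilde_noisy wt_root // (ltW theta_gt0).
  have f0 : f theta (fun=> 0) = p.[wt theta].
    by rewrite /f !noisy_mx0 // pE hE raddf0 add0r.
  rewrite !fctE Ef sum_second_difference_det_pencil ?ltW // -/f f0.
  by field; rewrite gt_eqF.
move: total; rewrite half_laplacianE -hE -/h2 -/(h1 0 w) -/(h12 0 w) => total.
apply: (mulIf h1w).
have -> : w' * (h2 0 w / h1 0 w) * h1 0 w = h2 0 w * w' by field.
have -> : h2 0 w * w' = - (((n1%:R - k%:R + 1) * (w - 1) + (n2%:R - k%:R + 1) * w) * h1 0 w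
    + w * (w - 1) * h12 0 w) by apply/eqP; rewrite -addr_eq0; apply/eqP.
by field.
Unshelve. all: by end_near. Qed.
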